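(* Let $\Omega$ be an interval $[a,b]$ or a rectangle in $\mathbb{R}^2$, and consider $u_t=-\Delta^2u$ in $\Omega$, $t>0$, with initial data $u_0$ and one of the following boundary conditions on $\partial\Omega$ with given data $g_1,\dots,g_4$ ($\nu$ the outward unit normal): (i) $u=g_1,\ \partial_\nu u=g_2$; (ii) $u=g_1,\ \Delta u=g_3$; (iii) $\partial_\nu u=g_2,\ \partial_\nu\Delta u=g_4$. Consider the semi-discrete DG scheme: find $(u_h,q_h)(\cdot,t)\in W_h\times W_h$ such that for all $\phi,\psi\in W_h$ $$(u_{ht},\phi)=-A^0(q_h,\phi)+\int_\Gamma\big(\widehat{\partial_\nu q_h}\,\phi+(q_h-\widehat{q_h})\partial_\nu\phi\big)ds,$$ $$(q_h,\psi)=A^0(u_h,\psi)-\int_\Gamma\big(\widehat{\partial_\nu u_h}\,\psi+(u_h-\widehat{u_h})\partial_\nu\psi\big)ds,$$ with $u_h(\cdot,0)$ the $L^2$ projection of $u_0$ onto $W_h$, and with boundary fluxes on $\Gamma$ given in the respective cases by (i) $\widehat{u_h}=g_1$, $\widehat{\partial_\nu u_h}=g_2$, $\widehat{q_h}=q_h$, $\widehat{\partial_\nu q_h}=\frac{\beta_1}{h}(g_1-u_h)+\partial_\nu q_h$; (ii) $\widehat{u_h}=g_1$, $\widehat{\partial_\nu u_h}=\frac{\beta_0}{h}(g_1-u_h)+\partial_\nu u_h$, $\widehat{q_h}=-g_3$, $\widehat{\partial_\nu q_h}=\frac{\beta_0}{h}(-g_3-q_h)+\partial_\nu q_h$; (iii)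 $\widehat{u_h}=u_h$, $\widehat{\partial_\nu u_h}=g_2$, $\widehat{q_h}=q_h$, $\widehat{\partial_\nu q_h}=-g_4$. Let $u_h$ and $\widetilde u_h$ be the numerical solutions satisfying the same boundary conditions (same case and same data $g_i$) associated with the initial conditions $u_0$ and $\widetilde u_0$, respectively. Then the scheme is stable in the sense that $$\|u_h-\widetilde u_h\|\le\|u_0-\widetilde u_0\|\qquad\text{for all }t>0,$$ provided that $\beta_1\ge0$ in case (i), for every $\beta_0\in\mathbb{R}$ in case (ii), and with no flux parameter needed in case (iii).
   Context: In one dimension: $[a,b]$ is partitioned into cells $I_j=[x_{j-1/2},x_{j+1/2}]$, $j=1,\dots,N$, $x_{1/2}=a$, $x_{N+1/2}=b$; $W_h=V_h^k$ is the space of functions that are polynomials of degree at most $k$ on each cell; $\Gamma=\{a,b\}$ and $\int_\Gamma$ means the sum over the two endpoints, with $\partial_\nu=-\partial_x$ at $a$ and $\partial_\nu=\partial_x$ at $b$. In two dimensions: $\Omega$ is partitioned by a uniform rectangular mesh with cells $I_{i,j}=[x_{i-1/2},x_{i+1/2}]\times[y_{j-1/2},y_{j+1/2}]$, $1\le i\le N$, $1\le j\le M$; $W_h=Q_h$ is the space of functions that on each cell are tensor-product polynomials of degree at most $k$ in each variable; $\Gamma$ is the union of all boundary edges. At interior interfaces $\{v\}=\frac12(v^-+v^+)$ and $[v]=v^+-v^-$, where $v^\pm$ are the traces from the side of larger/smaller coordinate. $A^0$ is the penalty-free DG form without boundary terms: in one dimension $$A^0(w,v)=\sum_{j=1}^N\int_{I_j}w_xv_x\,dx+\sum_{j=1}^{N-1}\big(\{w_x\}[v]+[w]\{v_x\}\big)_{j+1/2},$$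 and in two dimensions $$A^0(w,v)=\sum_{i,j}\iint_{I_{i,j}}\nabla w\cdot\nabla v\,dxdy+\sum_{i=1}^{N-1}\sum_{j=1}^M\int_{y_{j-1/2}}^{y_{j+1/2}}\big(\{w_x\}[v]+\{v_x\}[w]\big)_{x_{i+1/2}}dy+\sum_{i=1}^N\sum_{j=1}^{M-1}\int_{x_{i-1/2}}^{x_{i+1/2}}\big(\{w_y\}[v]+\{v_y\}[w]\big)_{y_{j+1/2}}dx.$$ On the boundary, $u_h,q_h,\phi,\psi$ and their normal derivatives denote traces from inside $\Omega$, and $h=\mathrm{diam}(K)$ for the cell $K$ adjacent to the boundary edge. $(\cdot,\cdot)$, $\|\cdot\|$ are the $L^2(\Omega)$ inner product and norm. *)

(* Defs.v *)
From HB Require Import structures.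
From mathcomp Require Import all_boot all_order all_algebra.
From mathcomp Require Import polyXY.
From mathcomp Require Import all_classical all_reals all_analysis.
Set Implicit Arguments.
Unset Strict Implicit.
Unset Printing Implicit Defensive.
Import Order.TTheory GRing.Theory Num.Theory.
Import numFieldNormedType.Exports.
Local Open Scope classical_set_scope.
Local Open Scope ring_scope.

(* Real-valued functions on a set D are functions on the ambient type of which
   only the restriction to D matters ([f \_ D] is f extended by 0 off D). *)

Definition L2_mem (d : measure_display) (T : measurableType d) (R : realType)
    (mu : {measure set T -> \bar R}) (D : set T) (f : T -> R) : Prop :=
  f \_ D \in Lfun mu 2%:E.

Definition L2_norm (d : measure_display) (T : measurableType d) (R : realType)
    (mu : {measure set T -> \bar R}) (D : set T) (f : T -> R) : \bar R :=
  ('N[mu]_2%:E [EFin \o (f \_ D)])%E.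

Definition L2_ip (d : measure_display) (T : measurableType d) (R : realType)
    (mu : {measure set T -> \bar R}) (D : set T) (f g : T -> R) : R :=
  \int[mu]_(z in D) (f z * g z).

Definition avg (R : realType) (vm vp : R) : R := (vm + vp) / 2%:R.
Definition jump (R : realType) (vm vp : R) : R := vp - vm.

(* Boundary conditions:
     Clamped : u = g1, d_nu u = g2
     Hinged  : u = g1, Delta u = g3
     Neumann : d_nu u = g2, d_nu (Delta u) = g4 *)
Variant bcase := Clamped | Hinged | Neumann.

Record bdata (R : realType) := BData { g1 : R; g2 : R; g3 : R; g4 : R }.

(* Value and outward normal derivative, from inside the domain, at a boundary
   point. *)
Record trace (R : realType) := Trace { tr_val : R; tr_dnu : R }.

Section Fluxes.
Variables (R : realType) (bc : bcase) (beta0 beta1 h : R) (g : bdata R).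
Implicit Types u q phi psi : trace R.

Definition hat_u u : R :=
  match bc with Clamped | Hinged => g1 g | Neumann => tr_val u end.

Definition hat_dnu_u u : R :=
  match bc with
  | Clamped | Neumann => g2 g
  | Hinged => beta0 / h * (g1 g - tr_val u) + tr_dnu u
  end.

Definition hat_q q : R :=
  match bc with Clamped | Neumann => tr_val q | Hinged => - g3 g end.

Definition hat_dnu_q u q : R :=
  match bc with
  | Clamped => beta1 / h * (g1 g - tr_val u) + tr_dnu q
  | Hinged => beta0 / h * (- g3 g - tr_val q) + tr_dnu q
  | Neumann => - g4 g
  end.

(* Integrands of the boundary terms of the first and second scheme equations. *)
Definition bnd_first u q phi : R :=
  hat_dnu_q u q * tr_val phi + (tr_val q - hat_q q) * tr_dnu phi.

Definition bnd_second u psi : R :=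
  hat_dnu_u u * tr_val psi + (tr_val u - hat_u u) * tr_dnu psi.

End Fluxes.

(* A solution of the semi-discrete scheme on t > 0.  W is a type of broken
   polynomials, inW the discrete space W_h, val the underlying function on
   Omega; bu t u q phi and bq t u psi are the boundary terms of the two
   equations at time t.  The time derivative is the pointwise partial
   derivative in t, and u_h attains its initial value (the L2 projection of
   u0 onto W_h) continuously. *)
Record dg_solution (d : measure_display) (T : measurableType d) (R : realType)
    (mu : {measure set T -> \bar R}) (Omega : set T)
    (W : Type) (inW : W -> Prop) (val : W -> T -> R) (A0 : W -> W -> R)
    (bu : R -> W -> W -> W -> R) (bq : R -> W -> W -> R)
    (u0 : T -> R) (uh qh : R -> W) : Prop := DGSolution {
  dg_u_mem : forall t, 0 <= t -> inW (uh t);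
  dg_q_mem : forall t, 0 < t -> inW (qh t);
  dg_init : forall phi, inW phi ->
    L2_ip mu Omega (val (uh 0)) (val phi) = L2_ip mu Omega u0 (val phi);
  dg_init_cont : forall z, val (uh t) z @[t --> 0^'+] --> val (uh 0) z;
  dg_derivable : forall t z, 0 < t -> derivable (fun s => val (uh s) z) t 1;
  dg_eq_u : forall t, 0 < t -> forall phi, inW phi ->
    L2_ip mu Omega (fun z => derive1 (fun s => val (uh s) z) t) (val phi) =
    - A0 (qh t) phi + bu t (uh t) (qh t) phi;
  dg_eq_q : forall t, 0 < t -> forall psi, inW psi ->
    L2_ip mu Omega (val (qh t)) (val psi) =
    A0 (uh t) psi - bq t (uh t) psi
}.

(* One dimension.  The node x j stands for x_{j+1/2}, so that the cells are
   [x j, x j.+1] for j < N.  A broken polynomial is a family of polynomials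
   of which only those of index j < N matter. *)

Definition mesh1 (R : realType) (a b : R) (N : nat) (x : nat -> R) : Prop :=
  [/\ (0 < N)%N, x 0 = a, x N = b & forall j, (j < N)%N -> x j < x j.+1].

Definition dg1 (R : realType) := nat -> {poly R}.

Section Dim1.
Variables (R : realType) (N : nat) (x : nat -> R).
Implicit Types w v u q phi psi : dg1 R.

Local Notation mu := (@lebesgue_measure R).

Definition dg1_mem (k : nat) w : Prop :=
  forall j, (j < N)%N -> (size (w j) <= k.+1)%N.

(* The value at the nodes, where w is double-valued, is set to 0. *)
Definition dg1_val w (s : R) : R :=
  \sum_(0 <= j < N) \1_(`]x j, x j.+1[%classic) s * (w j).[s].

(* The interface x j, 0 < j < N, lies between the cells j.-1 and j. *)
Definition A0_1 w v : R :=
  \sum_(0 <= j < N)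
    \int[mu]_(s in `[x j, x j.+1]) ((deriv (w j)).[s] * (deriv (v j)).[s])
  + \sum_(1 <= j < N)
    (avg (deriv (w j.-1)).[x j] (deriv (w j)).[x j]
       * jump (v j.-1).[x j] (v j).[x j]
     + jump (w j.-1).[x j] (w j).[x j]
       * avg (deriv (v j.-1)).[x j] (deriv (v j)).[x j]).

Definition trace1_l w : trace R :=
  Trace (w 0).[x 0] (- (deriv (w 0)).[x 0]).
Definition trace1_r w : trace R :=
  Trace (w N.-1).[x N] (deriv (w N.-1)).[x N].

Variables (bc : bcase) (beta0 beta1 : R) (g : R -> R -> bdata R).

Definition bnd1_first (t : R) u q phi : R :=
  bnd_first bc beta0 beta1 (x 1 - x 0) (g t (x 0))
    (trace1_l u) (trace1_l q) (trace1_l phi)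
  + bnd_first bc beta0 beta1 (x N - x N.-1) (g t (x N))
    (trace1_r u) (trace1_r q) (trace1_r phi).

Definition bnd1_second (t : R) u psi : R :=
  bnd_second bc beta0 (x 1 - x 0) (g t (x 0)) (trace1_l u) (trace1_l psi)
  + bnd_second bc beta0 (x N - x N.-1) (g t (x N)) (trace1_r u) (trace1_r psi).

End Dim1.

Definition dg1_solution (R : realType) (a b : R) (k N : nat) (x : nat -> R)
    (bc : bcase) (beta0 beta1 : R) (g : R -> R -> bdata R)
    (u0 : R -> R) (uh qh : R -> dg1 R) : Prop :=
  dg_solution (@lebesgue_measure R) `[a, b]%classic
    (dg1_mem N k) (dg1_val N x) (A0_1 N x)
    (bnd1_first N x bc beta0 beta1 g) (bnd1_second N x bc beta0 g) u0 uh qh.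

(* Two dimensions: the uniform mesh with N x M cells of the rectangle
   [a, b] x [c, e].  Cell (i, j) is
   [node a b N i, node a b N i.+1] x [node c e M j, node c e M j.+1]. *)

Record mesh2 (R : realType) := Mesh2 {
  xlo : R; xhi : R; ylo : R; yhi : R; nx : nat; ny : nat;
  xlohi : xlo < xhi; ylohi : ylo < yhi; nx_gt0 : (0 < nx)%N; ny_gt0 : (0 < ny)%N
}.

Definition node (R : realType) (a b : R) (N i : nat) : R :=
  a + i%:R * ((b - a) / N%:R).

Definition lebesgue2 (R : realType) :=
  (@lebesgue_measure R \x @lebesgue_measure R)%E.
Arguments lebesgue2 : clear implicits.

(* In w i j : {poly {poly R}}, the outer variable is x and the inner one y, and
   p.[x, y] is the value of p at the point (x, y). *)
Definition dg2 (R : realType) := nat -> nat -> {poly {poly R}}.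

Definition px (R : realType) (p : {poly {poly R}}) : {poly {poly R}} := deriv p.
Definition py (R : realType) (p : {poly {poly R}}) : {poly {poly R}} :=
  map_poly (@deriv R) p.

Section Dim2.
Variables (R : realType) (m : mesh2 R).
Implicit Types w v u q phi psi : dg2 R.

Local Notation mu := (@lebesgue_measure R).
Local Notation N := (nx m).
Local Notation M := (ny m).
Local Notation X := (node (xlo m) (xhi m) N).
Local Notation Y := (node (ylo m) (yhi m) M).

Definition rect : set (R * R) :=
  `[xlo m, xhi m]%classic `*` `[ylo m, yhi m]%classic.

Definition dg2_mem (k : nat) w : Prop :=
  forall i j, (i < N)%N -> (j < M)%N ->
    (size (w i j) <= k.+1)%N /\ (sizeY (w i j) <= k.+1)%N.

(* The value on the cell edges, where w is multi-valued, is set to 0. *)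
Definition dg2_val w (z : R * R) : R :=
  \sum_(0 <= i < N) \sum_(0 <= j < M)
    \1_(`]X i, X i.+1[%classic `*` `]Y j, Y j.+1[%classic) z
      * (w i j).[z.1, z.2].

Definition A0_2 w v : R :=
  \sum_(0 <= i < N) \sum_(0 <= j < M)
    \int[lebesgue2 R]_(z in `[X i, X i.+1]%classic `*` `[Y j, Y j.+1]%classic)
      ((px (w i j)).[z.1, z.2] * (px (v i j)).[z.1, z.2]
       + (py (w i j)).[z.1, z.2] * (py (v i j)).[z.1, z.2])
  + \sum_(1 <= i < N) \sum_(0 <= j < M)
    \int[mu]_(y in `[Y j, Y j.+1])
      (avg (px (w i.-1 j)).[X i, y] (px (w i j)).[X i, y]
         * jump (v i.-1 j).[X i, y] (v i j).[X i, y]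
       + avg (px (v i.-1 j)).[X i, y] (px (v i j)).[X i, y]
         * jump (w i.-1 j).[X i, y] (w i j).[X i, y])
  + \sum_(0 <= i < N) \sum_(1 <= j < M)
    \int[mu]_(x in `[X i, X i.+1])
      (avg (py (w i j.-1)).[x, Y j] (py (w i j)).[x, Y j]
         * jump (v i j.-1).[x, Y j] (v i j).[x, Y j]
       + avg (py (v i j.-1)).[x, Y j] (py (v i j)).[x, Y j]
         * jump (w i j.-1).[x, Y j] (w i j).[x, Y j]).

(* Diameter of every cell. *)
Definition diam2 : R :=
  Num.sqrt (((xhi m - xlo m) / N%:R) ^+ 2 + ((yhi m - ylo m) / M%:R) ^+ 2).

(* Traces on the left, right, bottom and top sides of the rectangle, along the
   edge of the j-th (resp. i-th) adjacent cell. *)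
Definition trace2_l (j : nat) (y : R) w : trace R :=
  Trace (w 0 j).[xlo m, y] (- (px (w 0 j)).[xlo m, y]).
Definition trace2_r (j : nat) (y : R) w : trace R :=
  Trace (w N.-1 j).[xhi m, y] (px (w N.-1 j)).[xhi m, y].
Definition trace2_b (i : nat) (x : R) w : trace R :=
  Trace (w i 0).[x, ylo m] (- (py (w i 0)).[x, ylo m]).
Definition trace2_t (i : nat) (x : R) w : trace R :=
  Trace (w i M.-1).[x, yhi m] (py (w i M.-1)).[x, yhi m].

(* Integral over the boundary of F p tr, where tr is the trace operator at the
   boundary point p. *)
Definition int_Gamma (F : R * R -> (dg2 R -> trace R) -> R) : R :=
  \sum_(0 <= j < M)
    (\int[mu]_(y in `[Y j, Y j.+1]) F (xlo m, y) (trace2_l j y)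
     + \int[mu]_(y in `[Y j, Y j.+1]) F (xhi m, y) (trace2_r j y))
  + \sum_(0 <= i < N)
    (\int[mu]_(x in `[X i, X i.+1]) F (x, ylo m) (trace2_b i x)
     + \int[mu]_(x in `[X i, X i.+1]) F (x, yhi m) (trace2_t i x)).

Definition integrable_Gamma (f : R * R -> R) : Prop :=
  [/\ mu.-integrable `[ylo m, yhi m] (fun y => (f (xlo m, y))%:E),
      mu.-integrable `[ylo m, yhi m] (fun y => (f (xhi m, y))%:E),
      mu.-integrable `[xlo m, xhi m] (fun x => (f (x, ylo m))%:E) &
      mu.-integrable `[xlo m, xhi m] (fun x => (f (x, yhi m))%:E)].

Variables (bc : bcase) (beta0 beta1 : R) (g : R -> R * R -> bdata R).

(* The data prescribed in the case at hand are integrable on the boundary, so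
   that the boundary terms of the scheme make sense. *)
Definition data2_ok : Prop :=
  forall t, 0 < t ->
  match bc with
  | Clamped => integrable_Gamma (fun p => g1 (g t p))
               /\ integrable_Gamma (fun p => g2 (g t p))
  | Hinged => integrable_Gamma (fun p => g1 (g t p))
              /\ integrable_Gamma (fun p => g3 (g t p))
  | Neumann => integrable_Gamma (fun p => g2 (g t p))
               /\ integrable_Gamma (fun p => g4 (g t p))
  end.

Definition bnd2_first (t : R) u q phi : R :=
  int_Gamma (fun p tr =>
    bnd_first bc beta0 beta1 diam2 (g t p) (tr u) (tr q) (tr phi)).

Definition bnd2_second (t : R) u psi : R :=
  int_Gamma (fun p tr => bnd_second bc beta0 diam2 (g t p) (tr u) (tr psi)).

End Dim2.

Definition dg2_solution (R : realType) (m : mesh2 R) (k : nat)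
    (bc : bcase) (beta0 beta1 : R) (g : R -> R * R -> bdata R)
    (u0 : R * R -> R) (uh qh : R -> dg2 R) : Prop :=
  dg_solution (lebesgue2 R) (rect m) (dg2_mem m k) (dg2_val m) (A0_2 m)
    (bnd2_first m bc beta0 beta1 g) (bnd2_second m bc beta0 g) u0 uh qh.

(* Main.v *)
(** Let e and p be the differences of the u- and q-components of the two
    solutions.  Testing the difference of the first equations with e and that
    of the second with p, the two A0 terms cancel because A0 is symmetric, and
    so do the consistent boundary terms and the data, whence
      (e_t, e) + ||p||^2 = - beta1/h * (integral of e^2 over the boundary)
    in the clamped case and (e_t, e) + ||p||^2 = 0 in the other two.  Lagrange
    interpolation on each cell expresses a discrete function through its values
    at finitely many points, so that pointwise differentiability and continuity
    in time make ||e||^2 a differentiable quadratic form that is nonincreasing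
    for t > 0 and continuous at 0.  Finally e(0) is the L2 projection of
    u0 - u0'. *)

Require Import Defs.
From HB Require Import structures.
From mathcomp Require Import all_boot all_order all_algebra.
From mathcomp Require Import polyXY qpoly ring lra.
From mathcomp Require Import all_classical all_reals all_analysis.
From mathcomp Require Import measurable_realfun.
Import Order.TTheory GRing.Theory Num.Theory.
Import numFieldNormedType.Exports.
Local Open Scope classical_set_scope.
Local Open Scope ring_scope.

Set Implicit Arguments.
Unset Strict Implicit.
Unset Printing Implicit Defensive.

(** * Bounded measurable functions and square integrability *)

Section BoundedMeasurable.
Context {d : measure_display} {T : measurableType d} {R : realType}.
Implicit Types (D E : set T) (f g : T -> R).

(** Stable under sums and products, and sufficient for integrability on a set of finite measure: the
    integrability conditions on polynomial integrands all reduce to it. *)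
Definition bmeas D f : Prop :=
  measurable_fun D f /\ exists M, forall z, D z -> `|f z| <= M.

Lemma bmeas_eq D f g : {in D, f =1 g} -> bmeas D f -> bmeas D g.
Proof.
move=> fg [mf [M fM]]; split; first exact: eq_measurable_fun fg mf.
by exists M => z Dz; rewrite -fg ?inE//; exact: fM.
Qed.

Lemma bmeas_cst D (c : R) : bmeas D (fun=> c).
Proof. by split; [exact: measurable_cst | exists `|c|]. Qed.

Lemma bmeasD D f g : bmeas D f -> bmeas D g -> bmeas D (fun z => f z + g z).
Proof.
move=> [mf [M fM]] [mg [N gN]]; split; first exact: measurable_funD.
exists (M + N) => z Dz; apply: le_trans (ler_normD _ _) _.
by rewrite lerD ?fM ?gN.
Qed.

Lemma bmeasM D f g : bmeas D f -> bmeas D g -> bmeas D (fun z => f z * g z).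
Proof.
move=> [mf [M fM]] [mg [N gN]]; split; first exact: measurable_funM.
by exists (M * N) => z Dz; rewrite normrM ler_pM ?fM ?gN.
Qed.

Lemma bmeasN D f : bmeas D f -> bmeas D (fun z => - f z).
Proof.
move=> bf; apply: (@bmeas_eq _ (fun z => -1 * f z)).
  by move=> z _; rewrite mulN1r.
exact: bmeasM (bmeas_cst _ _) bf.
Qed.

Lemma bmeasB D f g : bmeas D f -> bmeas D g -> bmeas D (fun z => f z - g z).
Proof. by move=> bf bg; exact: bmeasD bf (bmeasN bg). Qed.

Lemma bmeas_sum D (I : Type) (r : seq I) (F : I -> T -> R) :
  (forall i, bmeas D (F i)) -> bmeas D (fun z => \sum_(i <- r) F i z).
Proof.
move=> bF; elim: r => [|i r IH].
  by apply: bmeas_eq (bmeas_cst D 0) => z _; rewrite big_nil.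
by apply: bmeas_eq (bmeasD (bF i) IH) => z _; rewrite big_cons.
Qed.

Lemma bmeas_indic D E : measurable E -> bmeas D (\1_E : T -> R).
Proof.
move=> mE; split; first exact: measurable_indic.
exists 1 => z _; rewrite indicE; case: (z \in E) => /=.
  by rewrite normr1.
by rewrite normr0.
Qed.

Lemma bmeas_horner D f (p : {poly R}) :
  bmeas D f -> bmeas D (fun z => p.[f z]).
Proof.
move=> bf; elim/poly_ind: p => [|p c IH].
  by apply: bmeas_eq (bmeas_cst D 0) => z _; rewrite horner0.
apply: bmeas_eq (bmeasD (bmeasM IH bf) (bmeas_cst D c)) => z _.
by rewrite !hornerE.
Qed.

Lemma bmeas_horner2 D f g (p : {poly {poly R}}) :
  bmeas D f -> bmeas D g -> bmeas D (fun z => p.[f z, g z]).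
Proof.
move=> bf bg; elim/poly_ind: p => [|p c IH].
  by apply: bmeas_eq (bmeas_cst D 0) => z _; rewrite !horner0.
apply: bmeas_eq (bmeasD (bmeasM IH bf) (bmeas_horner c bg)) => z _.
by rewrite !hornerE.
Qed.

Lemma bmeas_bounded D f : bmeas D f -> [bounded f z | z in D].
Proof.
move=> [_ [M fM]]; exists M; split; first exact: num_real.
by move=> x Mx z Dz; apply: le_trans (fM z Dz) (ltW Mx).
Qed.

Variable mu : {measure set T -> \bar R}.

Lemma bmeas_integrable D f : measurable D -> (mu D < +oo)%E ->
  bmeas D f -> mu.-integrable D (EFin \o f).
Proof.
move=> mD Dfin bf; apply: measurable_bounded_integrable => //; first by case: bf.
exact: bmeas_bounded.
Qed.

Lemma integrable_bmeasM D f g : measurable D ->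
  mu.-integrable D (EFin \o f) -> bmeas D g ->
  mu.-integrable D (EFin \o (fun z => f z * g z)).
Proof.
move=> mD intf bg.
have /(eq_integrable mD _ _) := integrableMr mD (proj1 bg) (bmeas_bounded bg) intf.
by apply => z _ /=; rewrite EFinM muleC.
Qed.

(** Hölder's inequality with exponents 2 and 2, applied to the extensions of [f] and [g] by zero. *)
Lemma L2_integrableM D f g : measurable D ->
  L2_mem mu D f -> L2_mem mu D g -> mu.-integrable D (fun z => (f z * g z)%:E).
Proof.
move=> mD Lf Lg; apply/(integrable_mkcond _ mD).
have /Lfun1_integrable := Lfun2_mul_Lfun1 Lf Lg.
apply: eq_integrable => // z _; rewrite /= /patch.
by case: ifP => // _; rewrite mulr0.
Qed.

Lemma L2_memB D f g :
  L2_mem mu D f -> L2_mem mu D g -> L2_mem mu D (fun z => f z - g z).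
Proof.
rewrite /L2_mem => Lf Lg.
have -> : (fun z => f z - g z) \_ D = f \_ D - g \_ D.
  by apply/funext => z; rewrite /patch/= !fctE; case: ifP => //; rewrite subr0.
have p1 : (1 <= 2%:E :> \bar R)%E by rewrite lee1n.
by apply: (Lfun_addr_closed _ p1).2 => //; exact: Lfun_oppr_closed.
Qed.

Lemma L2_normE D f : measurable D ->
  L2_norm mu D f = ((\int[mu]_(z in D) (f z * f z)%:E) `^ 2^-1)%E.
Proof.
move=> mD; rewrite /L2_norm unlock /Lnorm; congr (_ `^ _)%E.
rewrite [RHS]integral_mkcond; apply: eq_integral => z _ /=.
rewrite /patch; case: ifP => _ /=; last by rewrite normr0 powR0.
by rewrite powR_mulrn// -normrX ger0_norm ?sqr_ge0.
Qed.

Lemma bmeas_L2 D f : measurable D -> (mu D < +oo)%E -> bmeas D f -> L2_mem mu D f.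
Proof.
move=> mD Dfin bf; rewrite /L2_mem inE; apply/andP; split; rewrite inE/=.
  by apply/(measurable_restrictT _ mD); case: bf.
rewrite /finite_norm -/(L2_norm mu D f) L2_normE// poweR_lty//.
by have /integrable_lty := bmeas_integrable mD Dfin (bmeasM bf bf); exact.
Qed.

(** [L2_ip] is real-valued while [L2_norm] is extended-real. Integrability of the squares makes both
    integrals finite, so [fine] loses nothing, and the square root is monotone. *)
Lemma L2_norm_le D f g : measurable D ->
  mu.-integrable D (fun z => (f z * f z)%:E) ->
  mu.-integrable D (fun z => (g z * g z)%:E) ->
  L2_ip mu D f f <= L2_ip mu D g g -> (L2_norm mu D f <= L2_norm mu D g)%E.
Proof.
move=> mD intf intg fg; rewrite !L2_normE//.
have sq0 (h : T -> R) : (0 <= \int[mu]_(z in D) (h z * h z)%:E)%E.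
  by apply: integral_ge0 => z _; rewrite lee_fin -expr2 sqr_ge0.
rewrite gt0_ler_poweR ?in_itv/= ?sq0 ?leey//.
rewrite -[leLHS]fineK; last exact: integrable_fin_num.
by rewrite -[leRHS]fineK ?lee_fin//; exact: integrable_fin_num.
Qed.

End BoundedMeasurable.

(** * Bilinearity of the inner product *)

Section L2InnerProduct.
Context {d : measure_display} {T : measurableType d} {R : realType}.
Variables (mu : {measure set T -> \bar R}) (D : set T).
Hypothesis mD : measurable D.
Implicit Types f g h : T -> R.

Lemma L2_ipC f g : L2_ip mu D f g = L2_ip mu D g f.
Proof. by apply: eq_Rintegral => z _; rewrite mulrC. Qed.

Lemma L2_ip_ge0 f : 0 <= L2_ip mu D f f.
Proof. by apply: Rintegral_ge0 => z _; rewrite -expr2 sqr_ge0. Qed.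

Lemma L2_ipBl f g h : L2_mem mu D f -> L2_mem mu D g -> L2_mem mu D h ->
  L2_ip mu D (fun z => f z - g z) h = L2_ip mu D f h - L2_ip mu D g h.
Proof.
move=> Lf Lg Lh; rewrite /L2_ip -RintegralB//; try exact: L2_integrableM.
by apply: eq_Rintegral => z _; rewrite mulrBl.
Qed.

Lemma L2_ipBr f g h : L2_mem mu D f -> L2_mem mu D g -> L2_mem mu D h ->
  L2_ip mu D h (fun z => f z - g z) = L2_ip mu D h f - L2_ip mu D h g.
Proof. by move=> *; rewrite L2_ipC L2_ipBl// !(L2_ipC h). Qed.

(** Expresses the inner product through the Gram matrix of the [L i]. When the coefficients depend
    on time, the integrals on the right do not, so no derivative has to pass under an integral
    sign. *)
Lemma L2_ip_sumsum (I : finType) (L : I -> T -> R) (a b : I -> R) :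
  (forall i, L2_mem mu D (L i)) ->
  L2_ip mu D (fun z => \sum_i a i * L i z) (fun z => \sum_j b j * L j z)
  = \sum_i \sum_j a i * b j * L2_ip mu D (L i) (L j).
Proof.
move=> LL.
have intL i j := L2_integrableM mD (LL i) (LL j).
(* Integrability and the sum formula are proved together, since the induction step of the second
   needs the first for the tail. *)
have Rsum (J : Type) (r : seq J) (F : J -> T -> R) :
    (forall j, mu.-integrable D (EFin \o F j)) ->
    mu.-integrable D (EFin \o (fun z => \sum_(j <- r) F j z)) /\
    \int[mu]_(z in D) (\sum_(j <- r) F j z) = \sum_(j <- r) \int[mu]_(z in D) F j z.
  move=> intF; elim: r => [|j r [IH1 IH2]].
    split; last first.
      rewrite big_nil -[RHS](mul0r (fine (mu D))) -Rintegral_cst//.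
      by apply: eq_Rintegral => z _; rewrite big_nil.
    by apply: eq_integrable (integrable0 _ _) => // z _; rewrite /= big_nil.
  split.
    by apply: eq_integrable (integrableD mD (intF j) IH1) => // z _;
      rewrite /= big_cons.
  rewrite big_cons -IH2 -RintegralD//.
  by apply: eq_Rintegral => z _; rewrite big_cons.
have intZ i j : mu.-integrable D (EFin \o (fun z => a i * b j * (L i z * L j z))).
  by have := integrableZl mD (a i * b j) (intL i j).
transitivity (\int[mu]_(z in D) \sum_i \sum_j (a i * b j * (L i z * L j z))).
  apply: eq_Rintegral => z _; rewrite big_distrl/=; apply: eq_bigr => i _.
  by rewrite big_distrr/=; apply: eq_bigr => j _; rewrite mulrACA.
rewrite (proj2 (Rsum _ _ (fun i z => \sum_j (a i * b j * (L i z * L j z))) _)).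
  apply: eq_bigr => i _; rewrite (proj2 (Rsum _ _ _ (intZ i))).
  by apply: eq_bigr => j _; rewrite RintegralZl//; exact: intL.
by move=> i; exact: (proj1 (Rsum _ _ _ (intZ i))).
Qed.

End L2InnerProduct.

(** * Derivatives and limits of finite sums; the balance of the tested equations *)

Lemma is_derive_bigsum {R : realType} (I : Type) (r : seq I) (f : I -> R -> R)
    (df : I -> R) (t : R) : (forall i, is_derive t 1 (f i) (df i)) ->
  is_derive t 1 (fun s => \sum_(i <- r) f i s) (\sum_(i <- r) df i).
Proof.
move=> fdf; elim: r => [|i r IH].
  rewrite big_nil (_ : (fun _ => _) = cst 0); first exact: is_derive_cst.
  by apply/funext => s; rewrite big_nil.
rewrite big_cons (_ : (fun _ => _) = f i + (fun s => \sum_(i <- r) f i s)).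
  exact: is_deriveD.
by apply/funext => s; rewrite big_cons.
Qed.

Lemma cvg_bigsum {T : Type} {F : set_system T} {FF : Filter F} {R : realType}
    (I : Type) (r : seq I) (f : I -> T -> R) (l : I -> R) :
  (forall i, f i x @[x --> F] --> l i) ->
  \sum_(i <- r) f i x @[x --> F] --> \sum_(i <- r) l i.
Proof.
move=> fl; elim: r => [|i r IH].
  under eq_cvg do rewrite big_nil.
  by rewrite big_nil; exact: cvg_cst.
under eq_cvg do rewrite big_cons.
by rewrite big_cons; exact: cvgD.
Qed.

(** Here [x1], [x2] stand for the values of [A0] in the two first equations, [y1], [y2] for those in
    the second ones, and the [b], [c] for the boundary terms. The third premise is the nonnegativity
    of the squared norm of the q-error, and the conclusion bounds the inner product of the u-error
    with its time derivative. *)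
Lemma energy_balance {R : realFieldType} (x1 x2 y1 y2 b1 b2 c1 c2 : R) :
  x1 - x2 = y1 - y2 -> b1 - b2 <= c1 - c2 -> 0 <= (y1 - c1) - (y2 - c2) ->
  (- x1 + b1) - (- x2 + b2) <= 0.
Proof. lra. Qed.

(** * The energy estimate for an abstract discrete scheme *)

Section Stability.
Context {d : measure_display} {T : measurableType d} {R : realType}.
Variables (mu : {measure set T -> \bar R}) (Omega : set T).
Hypotheses (mOmega : measurable Omega) (Omega_fin : (mu Omega < +oo)%E).
Variables (W : Type) (inW : W -> Prop) (val : W -> T -> R) (sub : W -> W -> W).
Hypothesis inW_sub : forall u v, inW u -> inW v -> inW (sub u v).
Hypothesis val_sub : forall u v z, val (sub u v) z = val u z - val v z.
(** Interpolation points and their Lagrange functions. Through them a discrete function depends on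
    time only via finitely many scalar coefficients, for which pointwise regularity in time
    suffices. *)
Variables (I : finType) (pt : I -> T) (L : I -> T -> R).
Hypothesis bmeasL : forall i, bmeas Omega (L i).
Hypothesis val_interp :
  forall w, inW w -> forall z, val w z = \sum_i val w (pt i) * L i z.
Variables (A0 : W -> W -> R).
Variables (bu : R -> W -> W -> W -> R) (bq : R -> W -> W -> R).
Hypothesis A0C : forall w v, A0 w v = A0 v w.
Hypothesis A0_sub : forall u v w, A0 (sub u v) w = A0 u w - A0 v w.
(** The property required of the fluxes, with the u-error as test function on the left and the
    q-error on the right. An inequality leaves room for the penalty of the clamped case. *)
Hypothesis bnd_le : forall (t : R) u q u' q', 0 < t ->
  bu t u q (sub u u') - bu t u' q' (sub u u')
  <= bq t u (sub q q') - bq t u' (sub q q').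

Local Notation solution := (dg_solution mu Omega inW val A0 bu bq).
Local Notation ip := (L2_ip mu Omega).
Local Notation L2 := (L2_mem mu Omega).

Let L2_comb (a : I -> R) : L2 (fun z => \sum_i a i * L i z).
Proof.
apply: bmeas_L2 => //; apply: bmeas_sum => i.
exact: bmeasM (bmeas_cst _ _) (bmeasL i).
Qed.

Let val_comb w : inW w -> val w = fun z => \sum_i val w (pt i) * L i z.
Proof. by move=> Ww; apply/funext => z; exact: val_interp. Qed.

Let L2_val w : inW w -> L2 (val w).
Proof. by move=> /val_comb ->. Qed.

Let L2_L i : L2 (L i). Proof. exact: bmeas_L2. Qed.

Let derive_comb u0 uh qh (t : R) z : solution u0 uh qh -> 0 < t ->
  derive1 (fun s => val (uh s) z) t
  = \sum_i derive1 (fun s => val (uh s) (pt i)) t * L i z.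
Proof.
move=> sol t0.
have D i : is_derive t 1 (fun s => val (uh s) (pt i) * L i z)
    (derive1 (fun s => val (uh s) (pt i)) t * L i z).
  have dv : is_derive t 1 (fun s => val (uh s) (pt i))
      (derive1 (fun s => val (uh s) (pt i)) t).
    by rewrite derive1E; apply: derivableP; exact: dg_derivable sol _ _ t0.
  have := is_deriveM dv (is_derive_cst (L i z) t 1).
  rewrite scaler0 add0r.
  by rewrite [_ *: _]mulrC; apply.
have /@derive_val := is_derive_bigsum (index_enum I) D => <-.
(* Interpolation is available only at nonnegative times, so the two functions of time agree near
   [t > 0] but perhaps not everywhere. *)
rewrite derive1E; apply: near_eq_derive.
near=> s; apply: val_interp; apply: (dg_u_mem sol); apply: ltW.
by near: s; exact: lt_nbhsr.
Unshelve. all: by end_near. Qed.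

Variables (u0 u0' : T -> R) (uh qh uh' qh' : R -> W).
Hypotheses (L2u0 : L2 u0) (L2u0' : L2 u0').
Hypotheses (sol : solution u0 uh qh) (sol' : solution u0' uh' qh').

Let e (t : R) := sub (uh t) (uh' t).
Let c i (t : R) := val (e t) (pt i).
Let dc i (t : R) : R := derive1 (fun s => val (uh s) (pt i)) t
              - derive1 (fun s => val (uh' s) (pt i)) t.

Let We (t : R) : 0 <= t -> inW (e t).
Proof.
move=> t0; apply: inW_sub; first exact: dg_u_mem sol _ t0.
exact: dg_u_mem sol' _ t0.
Qed.

(** Defined from the coefficients, as a quadratic form that can be differentiated termwise; for
    [t >= 0] it is the squared norm of the u-error. *)
Let energy (t : R) := \sum_i \sum_j c i t * c j t * ip (L i) (L j).

Let energyE (t : R) : 0 <= t -> energy t = ip (val (e t)) (val (e t)).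
Proof. by move=> /We /val_comb ->; rewrite L2_ip_sumsum. Qed.

Let energy_derive (t : R) : 0 < t ->
  is_derive t 1 energy (2 * ip (fun z => \sum_i dc i t * L i z) (val (e t))).
Proof.
move=> t0.
have Dc i : is_derive t 1 (c i) (dc i t).
  have -> : c i = (fun s => val (uh s) (pt i)) - (fun s => val (uh' s) (pt i)).
    by apply/funext => s; rewrite /c val_sub.
  rewrite /dc !derive1E; apply: is_deriveB; apply: derivableP.
    exact: dg_derivable sol _ _ t0.
  exact: dg_derivable sol' _ _ t0.
rewrite (val_comb (We (ltW t0))) L2_ip_sumsum//.
set S := \sum_i _.
(* The product rule gives two double sums, which coincide after exchanging the indices because the
   Gram matrix is symmetric. *)
have -> : 2 * S = \sum_i \sum_j (c i t * dc j t + c j t * dc i t) * ip (L i) (L j).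
  under [RHS]eq_bigr do under eq_bigr do rewrite mulrDl.
  under [RHS]eq_bigr do rewrite big_split.
  rewrite big_split/= mulrDl mul1r; congr (_ + _).
    rewrite exchange_big; apply: eq_bigr => i _; apply: eq_bigr => j _.
    by rewrite (mulrC (dc _ _)) L2_ipC.
  by apply: eq_bigr => i _; apply: eq_bigr => j _; rewrite (mulrC (dc _ _)).
apply: is_derive_bigsum => i; apply: is_derive_bigsum => j.
have := is_deriveM (is_deriveM (Dc i) (Dc j)) (is_derive_cst (ip (L i) (L j)) t 1).
by rewrite scaler0 add0r [_ *: (_ + _)]mulrC; apply.
Qed.

Let energy_derive_le0 (t : R) : 0 < t ->
  ip (fun z => \sum_i dc i t * L i z) (val (e t)) <= 0.
Proof.
move=> t0; set v := e t; pose p := sub (qh t) (qh' t).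
have Wv : inW v := We (ltW t0).
have Wq := dg_q_mem sol t0; have Wq' := dg_q_mem sol' t0.
have Wp : inW p := inW_sub Wq Wq'.
have eu := dg_eq_u sol t0 Wv; have eu' := dg_eq_u sol' t0 Wv.
have eq := dg_eq_q sol t0 Wp; have eq' := dg_eq_q sol' t0 Wp.
(* The coefficient form of the derivative is turned back into the pointwise time derivatives in
   which the scheme is stated. *)
have -> : ip (fun z => \sum_i dc i t * L i z) (val v) =
    ip (fun z => derive1 (fun s => val (uh s) z) t) (val v)
    - ip (fun z => derive1 (fun s => val (uh' s) z) t) (val v).
  have derive_fun u uh1 qh1 : solution u uh1 qh1 ->
      (fun z => derive1 (fun s => val (uh1 s) z) t)
      = fun z => \sum_i derive1 (fun s => val (uh1 s) (pt i)) t * L i z.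
    by move=> sol1; apply/funext => z; exact: derive_comb sol1 t0.
  rewrite (derive_fun _ _ _ sol) (derive_fun _ _ _ sol').
  rewrite -L2_ipBl//; last exact: L2_val.
  congr (L2_ip _ _ _ _); apply/funext => z; rewrite -sumrB.
  by apply: eq_bigr => i _; rewrite mulrBl.
have pp : ip (val (qh t)) (val p) - ip (val (qh' t)) (val p) = ip (val p) (val p).
  rewrite -L2_ipBl//; try exact: L2_val.
  congr (L2_ip _ _ _ _).
  by apply/funext => z; rewrite val_sub.
(* The scheme now replaces every inner product by [A0] and boundary terms; it remains to identify
   [A0 p v] with [A0 v p]. *)
have := L2_ip_ge0 mu Omega (val p); rewrite -pp eq eq' eu eu'.
apply: energy_balance (bnd_le (uh t) (qh t) (uh' t) (qh' t) t0).
by rewrite -!A0_sub A0C.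
Qed.

Let energy_le (s t : R) : 0 < s -> s <= t -> energy t <= energy s.
Proof.
move=> s0 st.
have D x : x \in `[s, t]%R -> derivable energy x 1.
  rewrite in_itv/= => /andP[sx _].
  exact: (@ex_derive _ _ _ _ _ _ _ (energy_derive (lt_le_trans s0 sx))).
apply: (@ler0_derive1_le_cc _ energy s t) => //; rewrite ?in_itv/= ?lexx ?st//.
- by move=> x xst; apply: D; exact: subset_itv_oo_cc xst.
- move=> x; rewrite in_itv/= => /andP[/(lt_trans s0) x0 _].
  rewrite derive1E (@derive_val _ _ _ _ _ _ _ (energy_derive x0)).
  by rewrite pmulr_rle0 ?energy_derive_le0.
- exact: derivable_within_continuous.
Qed.

(** Monotonicity is known only between positive times; right-continuity of the coefficients at 0
    carries it to the initial time. *)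
Let energy_le0 (t : R) : 0 < t -> energy t <= energy 0.
Proof.
move=> t0.
have cvgE : energy s @[s --> 0^'+] --> energy 0.
  apply: cvg_bigsum => i; apply: cvg_bigsum => j.
  have cvgc k : c k s @[s --> 0^'+] --> c k 0.
    rewrite /c val_sub; under eq_cvg do rewrite val_sub.
    by apply: cvgB; [exact: dg_init_cont sol _ | exact: dg_init_cont sol' _].
  by apply: cvgM; [exact: cvgM | exact: cvg_cst].
rewrite -(cvg_lim _ cvgE)//; apply: limr_ge; first by apply/cvg_ex; exists (energy 0).
near=> s; apply: energy_le; first by near: s; exact: nbhs_right_gt.
by near: s; exact: nbhs_right_le.
Unshelve. all: by end_near. Qed.

(** An orthogonal projection does not increase the norm: with [v] the projection of [f],
    [ip f v = ip v v], so the squared norm of [f - v] is [ip f f - ip v v], and it is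
    nonnegative. *)
Let energy0_le : energy 0 <= ip (fun z => u0 z - u0' z) (fun z => u0 z - u0' z).
Proof.
have We0 := We (lexx 0); have L2e := L2_val We0.
rewrite energyE//; set v := val (e 0); set f := fun z => _.
have L2f : L2 f := L2_memB L2u0 L2u0'.
(* Both initial conditions are tested with [v] itself, which lies in the discrete space. *)
have fv : ip f v = ip v v.
  rewrite {1}/f L2_ipBl// -(dg_init sol We0) -(dg_init sol' We0) -L2_ipBl//.
  - by congr (L2_ip _ _); apply/funext => z; rewrite /v val_sub.
  - exact: L2_val (dg_u_mem sol (lexx 0)).
  - exact: L2_val (dg_u_mem sol' (lexx 0)).
clearbody f; have := L2_ip_ge0 mu Omega (fun z => f z - v z).
have L2fv : L2 (fun z => f z - v z) := L2_memB L2f L2e.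
by rewrite L2_ipBl// !L2_ipBr// (L2_ipC _ _ v f) fv; lra.
Qed.

Lemma dg_stability (t : R) : 0 < t ->
  (L2_norm mu Omega (fun z => (val (uh t) z - val (uh' t) z)%R)
   <= L2_norm mu Omega (fun z => (u0 z - u0' z)%R))%E.
Proof.
move=> t0; have L2e := L2_val (We (ltW t0)).
have L2f := L2_memB L2u0 L2u0'.
have <- : val (e t) = fun z => val (uh t) z - val (uh' t) z.
  by apply/funext => z; rewrite val_sub.
apply: L2_norm_le => //; try exact: L2_integrableM.
by rewrite -(energyE (ltW t0)); apply: le_trans (energy_le0 t0) energy0_le.
Qed.

End Stability.

(** * Differences of integrals, pointwise comparison of the boundary terms, intervals *)

Lemma RintegralB_bmeas {d} {T : measurableType d} {R : realType}
    (mu : {measure set T -> \bar R}) (D : set T) (f g h : T -> R) :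
  measurable D -> (mu D < +oo)%E -> bmeas D f -> bmeas D g ->
  (forall z, h z = f z - g z) ->
  \int[mu]_(z in D) h z = \int[mu]_(z in D) f z - \int[mu]_(z in D) g z.
Proof.
move=> mD Dfin bf bg hE; rewrite -RintegralB//; try exact: bmeas_integrable.
by apply: eq_Rintegral => z _.
Qed.

(* The consistent terms cancel by symmetry; only the penalty
   [beta1 / h * (u - u') ^+ 2] of the clamped case survives. *)
Lemma bnd_first_le {R : realType} (bc : bcase) (beta0 beta1 h : R) (g : bdata R)
    (u u' q q' e p : trace R) :
  (bc = Clamped -> 0 <= beta1) -> 0 <= h ->
  tr_val e = tr_val u - tr_val u' -> tr_dnu e = tr_dnu u - tr_dnu u' ->
  tr_val p = tr_val q - tr_val q' -> tr_dnu p = tr_dnu q - tr_dnu q' ->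
  bnd_first bc beta0 beta1 h g u q e - bnd_first bc beta0 beta1 h g u' q' e
  <= bnd_second bc beta0 h g u p - bnd_second bc beta0 h g u' p.
Proof.
move=> b1 h0 ev en pv pn; rewrite /bnd_first /bnd_second ev en pv pn {e p ev en pv pn}.
case: u u' q q' => [u un] [u' un'] [q qn] [q' qn'].
case: bc b1 => b1 /=; rewrite -subr_ge0.
- have pen : 0 <= beta1 / h * (u - u') ^+ 2.
    by rewrite mulr_ge0 ?sqr_ge0// divr_ge0// b1.
  by rewrite (_ : _ - _ = beta1 / h * (u - u') ^+ 2)//; ring.
- by rewrite le_eqVlt; apply/orP; left; apply/eqP; ring.
- by rewrite le_eqVlt; apply/orP; left; apply/eqP; ring.
Qed.

Lemma bmeas_itv {R : realType} (a b : R) : bmeas `[a, b] (fun s : R => s).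
Proof.
split; first exact: measurable_id.
exists (`|a| + `|b|) => s /=; rewrite in_itv/= => /andP[as_ sb].
rewrite ler_norml; have := ler_norm b; have := ler_norm (- a).
by rewrite normrN; have := normr_ge0 a; have := normr_ge0 b; lra.
Qed.

Lemma lebesgue_itv_fin {R : realType} (a b : R) :
  (lebesgue_measure `[a, b]%classic < +oo :> \bar R)%E.
Proof. by rewrite lebesgue_measure_itv/=; case: ifP => _; rewrite ?ltry. Qed.

(** * One-dimensional meshes *)

Section Mesh1.
Context {R : realType}.
Variables (a b : R) (N : nat) (x : nat -> R).
Hypothesis meshx : mesh1 a b N x.

Lemma mesh1_homo i j : (i <= j)%N -> (j <= N)%N -> x i <= x j.
Proof.
move=> ij jN; rewrite -(subnKC ij).
have : (i + (j - i) <= N)%N by rewrite subnKC.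
elim: (j - i)%N => [|n IH] inN; first by rewrite addn0.
rewrite addnS in inN *; apply: le_trans (IH (ltnW inN)) _.
by case: meshx => _ _ _ /(_ _ inN)/ltW.
Qed.

(** Distinct open cells are disjoint: by monotonicity of the nodes, a common point would lie
    strictly on both sides of a node. *)
Lemma mesh1_indic i j s : (i < N)%N -> (j < N)%N -> s \in `]x j, x j.+1[ ->
  \1_(`]x i, x i.+1[%classic) s = (i == j)%:R :> R.
Proof.
rewrite in_itv/= => iN jN /andP[js sj]; rewrite indicE; congr (nat_of_bool _)%:R.
have [->|ij] := eqVneq i j; first by apply/mem_set; rewrite /= in_itv/= js sj.
apply/negP => /set_mem; rewrite /= in_itv/= => /andP[is_ si].
case: (ltngtP i j) ij => // ij _.
- have := mesh1_homo ij (ltnW jN); rewrite leNgt => /negP; apply.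
  exact: lt_trans js si.
- have := mesh1_homo ij (ltnW iN); rewrite leNgt => /negP; apply.
  exact: lt_trans is_ sj.
Qed.

Lemma mesh1_sub j : (j < N)%N -> `[x j, x j.+1] `<=` `[a, b].
Proof.
move=> jN s /=; rewrite !in_itv/= => /andP[js sj].
case: meshx => _ <- <- _; apply/andP; split.
  by apply: le_trans js; apply: mesh1_homo => //; exact: ltnW.
by apply: le_trans sj _; exact: mesh1_homo.
Qed.

End Mesh1.

(** * Lagrange interpolation at interior points of an interval *)

Section Interpolation.
Context {R : realType}.

(* The factor [l.+1 / k.+2] keeps the points with [l <= k] inside the cell. *)
Definition sample (a b : R) (k l : nat) : R := a + (b - a) * (l.+1%:R / k.+2%:R).

Lemma sample_inj a b k : a < b -> injective (sample a b k).
Proof.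
move=> ab l m /addrI; rewrite -subr_gt0 in ab.
move/(mulfI (lt0r_neq0 ab))/(mulIf _) => /(_ _)/eqP.
by rewrite invr_eq0 pnatr_eq0 eqr_nat eqSS => /(_ isT)/eqP.
Qed.

Lemma sample_in a b k (l : 'I_k.+1) : a < b -> sample a b k l \in `]a, b[.
Proof.
move=> ab; rewrite in_itv/= /sample; rewrite -subr_gt0 in ab.
have k0 : 0 < k.+2%:R :> R by rewrite ltr0n.
rewrite ltrDl mulr_gt0 ?divr_gt0 ?ltr0n//= -ltrBrDl.
by rewrite gtr_pMr// ltr_pdivrMr// mul1r ltr_nat ltnS.
Qed.

Definition lagr (a b : R) (k : nat) (l : 'I_k.+1) : {poly R} :=
  tnth (k.+1.-lagrange (sample a b k)) l.

Lemma horner_lagr a b k (p : {poly R}) s : a < b -> (size p <= k.+1)%N ->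
  p.[s] = \sum_(l < k.+1) p.[sample a b k l] * (lagr a b l).[s].
Proof.
move=> ab sp; rewrite {1}(lagrange_gen (ltn0Sn k) (sample_inj (k := k) ab) sp).
by rewrite horner_sum; apply: eq_bigr => l _; rewrite !hornerE.
Qed.

End Interpolation.

(** * The scheme in one dimension *)

Section OneDim.
Context {R : realType}.
Variables (a b : R) (k N : nat) (x : nat -> R).
Hypothesis meshx : mesh1 a b N x.
Implicit Types u v w : dg1 R.

Definition dg1_sub u v : dg1 R := fun j => u j - v j.

Lemma dg1_sub_mem u v : dg1_mem N k u -> dg1_mem N k v ->
  dg1_mem N k (dg1_sub u v).
Proof.
move=> Wu Wv j jN; rewrite (leq_trans (size_polyD _ _))// size_polyN geq_max.
by rewrite Wu// Wv.
Qed.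

Lemma dg1_val_sub u v s : dg1_val N x (dg1_sub u v) s = dg1_val N x u s - dg1_val N x v s.
Proof.
rewrite /dg1_val -sumrB; apply: eq_bigr => j _.
by rewrite hornerD hornerN mulrBr.
Qed.

Lemma dg1_val_cell w j s : (j < N)%N -> s \in `]x j, x j.+1[ ->
  dg1_val N x w s = (w j).[s].
Proof.
move=> jN sj; rewrite /dg1_val big_mkord (bigD1 (Ordinal jN))//=.
rewrite (mesh1_indic meshx jN jN sj) eqxx mul1r big1 ?addr0// => i.
rewrite -val_eqE/= => /negbTE ij.
by rewrite (mesh1_indic meshx (ltn_ord i) jN sj) ij mul0r.
Qed.

(** Cellwise Lagrange interpolation. The sample points are interior to their cells, where [dg1_val]
    is the cell polynomial; the indicators make both sides vanish at the nodes, so the identity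
    holds for every [s]. *)
Lemma dg1_interp w s : dg1_mem N k w -> dg1_val N x w s =
  \sum_(i : 'I_N * 'I_k.+1) dg1_val N x w (sample (x i.1) (x i.1.+1) k i.2)
    * (\1_(`]x i.1, x i.1.+1[%classic) s * (lagr (x i.1) (x i.1.+1) i.2).[s]).
Proof.
move=> Ww; rewrite {1}/dg1_val big_mkord.
rewrite -(pair_bigA _ (fun (j : 'I_N) (l : 'I_k.+1) =>
  dg1_val N x w (sample (x j) (x j.+1) k l)
    * (\1_(`]x j, x j.+1[%classic) s * (lagr (x j) (x j.+1) l).[s])))/=.
apply: eq_bigr => j _.
have xj : x j < x j.+1 by case: meshx => _ _ _; apply.
rewrite (horner_lagr s xj (Ww j (ltn_ord j))) big_distrr/=.
apply: eq_bigr => l _; rewrite (@dg1_val_cell w j)//; last exact: sample_in.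
by rewrite mulrCA.
Qed.

Lemma A0_1C w v : A0_1 N x w v = A0_1 N x v w.
Proof.
rewrite /A0_1; congr (_ + _); apply: eq_bigr => j _.
  by apply: eq_Rintegral => s _; rewrite mulrC.
by rewrite addrC mulrC [X in _ + X]mulrC.
Qed.

Lemma A0_1_sub u v w : A0_1 N x (dg1_sub u v) w = A0_1 N x u w - A0_1 N x v w.
Proof.
rewrite /A0_1 opprD addrACA -!sumrB; congr (_ + _); apply: eq_bigr => j _.
  apply: RintegralB_bmeas => //; try exact: lebesgue_itv_fin.
  - by apply: bmeasM; apply: bmeas_horner; exact: bmeas_itv.
  - by apply: bmeasM; apply: bmeas_horner; exact: bmeas_itv.
  - by move=> s; rewrite derivB hornerD hornerN mulrBl.
by rewrite /dg1_sub /avg /jump !derivB !hornerD !hornerN; ring.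
Qed.

End OneDim.

Lemma dg1_stability {R : realType} (a b : R) (k N : nat) (x : nat -> R)
    (bc : bcase) (beta0 beta1 : R) (g : R -> R -> bdata R) (u0 u0' : R -> R)
    (uh qh uh' qh' : R -> dg1 R) :
  (bc = Clamped -> 0 <= beta1) -> mesh1 a b N x ->
  L2_mem lebesgue_measure `[a, b]%classic u0 ->
  L2_mem lebesgue_measure `[a, b]%classic u0' ->
  dg1_solution a b k N x bc beta0 beta1 g u0 uh qh ->
  dg1_solution a b k N x bc beta0 beta1 g u0' uh' qh' ->
  forall t, 0 < t ->
    (L2_norm lebesgue_measure `[a, b]%classic
       (fun s => (dg1_val N x (uh t) s - dg1_val N x (uh' t) s)%R)
     <= L2_norm lebesgue_measure `[a, b]%classic (fun s => (u0 s - u0' s)%R))%E.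
Proof.
move=> b1 meshx L2u0 L2u0' sol sol' t t0.
refine (dg_stability (mu := @lebesgue_measure R) (sub := @dg1_sub R)
  (I := ('I_N * 'I_k.+1)%type)
  (pt := fun i => sample (x i.1) (x i.1.+1) k i.2)
  (L := fun i s => \1_(`]x i.1, x i.1.+1[%classic) s
                   * (lagr (x i.1) (x i.1.+1) i.2).[s])
  _ _ _ _ _ _ _ _ _ L2u0 L2u0' sol sol' t0).
- by [].
- exact: lebesgue_itv_fin.
- exact: dg1_sub_mem.
- by move=> u v s; exact: dg1_val_sub.
- move=> i; apply: bmeasM; first by apply: bmeas_indic.
  by apply: bmeas_horner; exact: bmeas_itv.
- by move=> w Ww s; exact: (dg1_interp meshx).
- exact: A0_1C.
- exact: A0_1_sub.
(* The sums are regrouped by endpoint, so that the pointwise comparison applies to [a] and [b]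
   separately, with the length of the adjacent cell as [h]. *)
- move=> s u q u' q' _; rewrite /bnd1_first /bnd1_second [in leLHS]opprD [in leRHS]opprD.
  rewrite [leLHS]addrACA [leRHS]addrACA.
  have [N0 _ _ xinc] := meshx.
  have h1 : 0 <= x 1 - x 0 by rewrite subr_ge0 ltW// xinc.
  have h2 : 0 <= x N - x N.-1.
    by rewrite subr_ge0 ltW//; have := xinc N.-1; rewrite prednK//; apply.
  by apply: lerD; apply: bnd_first_le => //=;
    rewrite ?derivB !hornerD !hornerN ?opprD.
Qed.

(** * Boundary terms integrated over an edge *)

Section BoundaryIntegrals.
Context {d : measure_display} {T : measurableType d} {R : realType}.
Variables (mu : {measure set T -> \bar R}) (D : set T).
Hypotheses (mD : measurable D) (Dfin : (mu D < +oo)%E).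
Local Notation integrable f := (mu.-integrable D (EFin \o f)).

Let intD (f f' : T -> R) : integrable f -> integrable f' ->
  integrable (fun z => f z + f' z).
Proof. by move=> If If'; have := integrableD mD If If'. Qed.

Let intM (f f' : T -> R) : bmeas D f -> integrable f' ->
  integrable (fun z => f z * f' z).
Proof.
move=> bf If'; have := integrable_bmeasM mD If' bf.
by apply: eq_integrable => // z _ /=; rewrite mulrC.
Qed.

Let intN (f : T -> R) : integrable f -> integrable (fun z => - f z).
Proof. by move=> If; have := integrableN If. Qed.

Let intB (f : T -> R) : bmeas D f -> integrable f.
Proof. exact: bmeas_integrable. Qed.

(** The counterpart of [data2_ok] on a single set, to be used on one edge at a time. *)
Definition data_integrable (bc : bcase) (G : T -> bdata R) : Prop :=
  match bc with
  | Clamped => integrable (fun z => g1 (G z)) /\ integrable (fun z => g2 (G z))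
  | Hinged => integrable (fun z => g1 (G z)) /\ integrable (fun z => g3 (G z))
  | Neumann => integrable (fun z => g2 (G z)) /\ integrable (fun z => g4 (G z))
  end.

(** Satisfied by traces of discrete functions, which are polynomial along an edge. *)
Definition trace_bmeas (F : T -> trace R) : Prop :=
  bmeas D (fun z => tr_val (F z)) /\ bmeas D (fun z => tr_dnu (F z)).

(** The data enter linearly and are multiplied only by constants and traces: each product has at
    most one merely integrable factor, the others being bounded. *)
Lemma bnd_first_integrable bc beta0 beta1 h (G : T -> bdata R)
    (U Q P : T -> trace R) :
  data_integrable bc G -> trace_bmeas U -> trace_bmeas Q -> trace_bmeas P ->
  integrable (fun z => bnd_first bc beta0 beta1 h (G z) (U z) (Q z) (P z)).
Proof.
case: bc => -[IG1 IG2] [Uv Un] [Qv Qn] [Pv Pn]; rewrite /bnd_first /=.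
- apply: intD; last by apply/intB/bmeasM => //; exact: bmeasB.
  apply: integrable_bmeasM => //; apply: intD; last exact: intB.
  by apply: intM; [exact: bmeas_cst | apply: intD => //; apply/intB/bmeasN].
- apply: intD; apply: integrable_bmeasM => //.
    apply: intD; last exact: intB.
    apply: intM; first exact: bmeas_cst.
    by apply: intD; [exact: intN | apply/intB/bmeasN].
  by apply: intD; [exact: intB | do 2 apply: intN].
- apply: intD; last by apply/intB/bmeasM => //; exact: bmeasB.
  by apply: integrable_bmeasM => //; exact: intN.
Qed.

Lemma bnd_second_integrable bc beta0 h (G : T -> bdata R) (U P : T -> trace R) :
  data_integrable bc G -> trace_bmeas U -> trace_bmeas P ->
  integrable (fun z => bnd_second bc beta0 h (G z) (U z) (P z)).
Proof.
case: bc => -[IG1 IG2] [Uv Un] [Pv Pn]; rewrite /bnd_second /=.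
- apply: intD; apply: integrable_bmeasM => //.
  by apply: intD; [exact: intB | exact: intN].
- apply: intD; apply: integrable_bmeasM => //.
    apply: intD; last exact: intB.
    by apply: intM; [exact: bmeas_cst | apply: intD => //; apply/intB/bmeasN].
  by apply: intD; [exact: intB | exact: intN].
- apply: intD; first exact: integrable_bmeasM.
  by apply/intB/bmeasM => //; exact: bmeasB.
Qed.

(** Integrability of each boundary term allows the differences to be taken under the integral, where
    [bnd_first_le] applies pointwise. *)
Lemma Rintegral_bnd_le bc beta0 beta1 h (G : T -> bdata R)
    (U U' Q Q' E P : T -> trace R) :
  (bc = Clamped -> 0 <= beta1) -> 0 <= h -> data_integrable bc G ->
  trace_bmeas U -> trace_bmeas U' -> trace_bmeas Q -> trace_bmeas Q' ->
  trace_bmeas E -> trace_bmeas P ->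
  (forall z, tr_val (E z) = tr_val (U z) - tr_val (U' z)) ->
  (forall z, tr_dnu (E z) = tr_dnu (U z) - tr_dnu (U' z)) ->
  (forall z, tr_val (P z) = tr_val (Q z) - tr_val (Q' z)) ->
  (forall z, tr_dnu (P z) = tr_dnu (Q z) - tr_dnu (Q' z)) ->
  \int[mu]_(z in D) bnd_first bc beta0 beta1 h (G z) (U z) (Q z) (E z)
  - \int[mu]_(z in D) bnd_first bc beta0 beta1 h (G z) (U' z) (Q' z) (E z)
  <= \int[mu]_(z in D) bnd_second bc beta0 h (G z) (U z) (P z)
  - \int[mu]_(z in D) bnd_second bc beta0 h (G z) (U' z) (P z).
Proof.
move=> b1 h0 IG bU bU' bQ bQ' bE bP Ev En Pv Pn.
have I1 := bnd_first_integrable beta0 beta1 h IG bU bQ bE.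
have I2 := bnd_first_integrable beta0 beta1 h IG bU' bQ' bE.
have I3 := bnd_second_integrable beta0 h IG bU bP.
have I4 := bnd_second_integrable beta0 h IG bU' bP.
rewrite -!RintegralB//; apply: le_Rintegral => //.
- by apply: intD => //; exact: intN.
- by apply: intD => //; exact: intN.
- by move=> z _; exact: bnd_first_le.
Qed.

End BoundaryIntegrals.

(** * Bounded measurable functions on products and rectangles *)

Section ProductBoundedMeasurable.
Context {d1 d2 : measure_display} {T1 : measurableType d1}
  {T2 : measurableType d2} {R : realType}.
Variables (A : set T1) (B : set T2).
Hypotheses (mA : measurable A) (mB : measurable B).

Lemma bmeas_fst (f : T1 -> R) : bmeas A f -> bmeas (A `*` B) (fun z => f z.1).
Proof.
move=> [mf [M fM]]; split; last by exists M => z [Az _]; exact: fM.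
apply: (measurable_comp mA _ mf); first by move=> _ [z [Az _] <-].
exact: measurable_funTS measurable_fst.
Qed.

Lemma bmeas_snd (f : T2 -> R) : bmeas B f -> bmeas (A `*` B) (fun z => f z.2).
Proof.
move=> [mf [M fM]]; split; last by exists M => z [_ Bz]; exact: fM.
apply: (measurable_comp mB _ mf); first by move=> _ [z [_ Bz] <-].
exact: measurable_funTS measurable_snd.
Qed.

End ProductBoundedMeasurable.

Section Rectangle.
Context {R : realType}.
Variables (a b c e : R).
Local Notation D := (`[a, b]%classic `*` `[c, e]%classic).

Lemma measurable_rectangle : measurable D.
Proof. exact: measurableX. Qed.

Lemma lebesgue2_fin : (lebesgue2 R D < +oo)%E.
Proof.
rewrite /lebesgue2 product_measure1E//.
by rewrite lte_mul_pinfty ?ge0_fin_numE ?lebesgue_itv_fin.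
Qed.

Lemma bmeas_rectangle_horner2 (p : {poly {poly R}}) :
  bmeas D (fun z => p.[z.1, z.2]).
Proof.
apply: bmeas_horner2.
  exact: (bmeas_fst _ _ (bmeas_itv a b)).
exact: (bmeas_snd _ _ (bmeas_itv c e)).
Qed.

End Rectangle.

(** * Bivariate polynomials and tensor-product interpolation *)

Section Bivariate.
Context {R : realType}.
Implicit Types p q : {poly {poly R}}.

Lemma horner2_sub p q s r : (p - q).[s, r] = p.[s, r] - q.[s, r].
Proof. by rewrite !(hornerD, hornerN). Qed.

Lemma px_sub p q s r : (px (p - q)).[s, r] = (px p).[s, r] - (px q).[s, r].
Proof. by rewrite /px derivB horner2_sub. Qed.

Lemma py_sub p q s r : (py (p - q)).[s, r] = (py p).[s, r] - (py q).[s, r].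
Proof. by rewrite /py raddfB horner2_sub. Qed.

Lemma horner2_lagr_fst (a b : R) k p s r : a < b -> (size p <= k.+1)%N ->
  p.[s, r] = \sum_(l < k.+1) p.[sample a b k l, r] * (lagr a b l).[s].
Proof.
move=> ab sp.
(* Evaluating the coefficients at [r] is a ring morphism; it leaves a polynomial in the first
   variable of no larger size. *)
have mapE y : p.[y, r] = (map_poly (horner_eval r) p).[y].
  by rewrite -[y in RHS](hornerC y r) -[(y%:P).[r]]/(horner_eval r y%:P) horner_map.
rewrite mapE (horner_lagr s ab (leq_trans (size_poly _ _) sp)).
by apply: eq_bigr => l _; rewrite mapE.
Qed.

Lemma horner2_lagr (a b c e : R) k p s r : a < b -> c < e ->
  (size p <= k.+1)%N -> (sizeY p <= k.+1)%N ->
  p.[s, r] = \sum_(l < k.+1) \sum_(n < k.+1)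
    p.[sample a b k l, sample c e k n] * ((lagr a b l).[s] * (lagr c e n).[r]).
Proof.
move=> ab ce sp sYp; rewrite (horner2_lagr_fst s r ab sp).
(* Exchanging the variables reduces the second direction to the first, as [sizeY] is the size of the
   swapped polynomial. *)
apply: eq_bigr => l _; rewrite -horner2_swapXY.
rewrite (horner2_lagr_fst (k := k) _ _ ce); last by rewrite -sizeYE.
rewrite big_distrl/=; apply: eq_bigr => n _.
by rewrite horner2_swapXY mulrAC mulrA.
Qed.

End Bivariate.

(** Makes the results on one-dimensional meshes available in each coordinate of the rectangular
    mesh. *)
Lemma node_mesh1 {R : realType} (a b : R) (N : nat) : a < b -> (0 < N)%N ->
  mesh1 a b N (node a b N).
Proof.
move=> ab N0; have NR : 0 < N%:R :> R by rewrite ltr0n.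
split => //; first by rewrite /node mul0r addr0.
  by rewrite /node mulrCA divff ?lt0r_neq0// mulr1 subrKC.
move=> j _; rewrite /node ltrD2l ltr_pM2r ?ltr_nat//.
by rewrite divr_gt0// subr_gt0.
Qed.

(** * The discrete space and the form [A0_2] in two dimensions *)

Section TwoDim.
Context {R : realType}.
Variables (m : mesh2 R) (k : nat).
Implicit Types u v w : dg2 R.
Local Notation N := (nx m).
Local Notation M := (ny m).
Local Notation X := (node (xlo m) (xhi m) N).
Local Notation Y := (node (ylo m) (yhi m) M).

Let meshX : mesh1 (xlo m) (xhi m) N X.
Proof. exact: node_mesh1 (xlohi m) (nx_gt0 m). Qed.

Let meshY : mesh1 (ylo m) (yhi m) M Y.
Proof. exact: node_mesh1 (ylohi m) (ny_gt0 m). Qed.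

Definition dg2_sub u v : dg2 R := fun i j => u i j - v i j.

Lemma dg2_sub_mem u v : dg2_mem m k u -> dg2_mem m k v ->
  dg2_mem m k (dg2_sub u v).
Proof.
move=> Wu Wv i j iN jM; have [su Yu] := Wu i j iN jM.
have [sv Yv] := Wv i j iN jM; rewrite /dg2_sub; split.
  by rewrite (leq_trans (size_polyD _ _))// size_polyN geq_max su.
rewrite sizeYE raddfB (leq_trans (size_polyD _ _))// size_polyN geq_max.
by rewrite -!sizeYE Yu.
Qed.

Lemma dg2_val_sub u v z :
  dg2_val m (dg2_sub u v) z = dg2_val m u z - dg2_val m v z.
Proof.
rewrite /dg2_val -sumrB; apply: eq_bigr => i _; rewrite -sumrB.
by apply: eq_bigr => j _; rewrite horner2_sub mulrBr.
Qed.

Lemma indic_setX (A B : set R) (z : R * R) :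
  \1_(A `*` B) z = \1_A z.1 * \1_B z.2 :> R.
Proof. by rewrite !indicE in_setX -natrM mulnb. Qed.

Lemma dg2_val_cell w i j z : (i < N)%N -> (j < M)%N ->
  z.1 \in `]X i, X i.+1[ -> z.2 \in `]Y j, Y j.+1[ ->
  dg2_val m w z = (w i j).[z.1, z.2].
Proof.
move=> iN jM z1 z2; rewrite /dg2_val.
under eq_big_nat => i' /andP[_ i'N].
  under eq_big_nat => j' /andP[_ j'M].
    rewrite indic_setX (mesh1_indic meshX i'N iN z1) (mesh1_indic meshY j'M jM z2).
    over.
  over.
rewrite big_mkord (bigD1 (Ordinal iN))//= big_mkord (bigD1 (Ordinal jM))//=.
rewrite !eqxx mul1r mul1r !big1 ?addr0// => [i'|j']; rewrite -val_eqE/= => /negbTE ->.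
  by apply: big1_seq => j' _; rewrite !mul0r.
by rewrite mulr0 mul0r.
Qed.

(** The first pair selects a cell, the second a sample point in each coordinate. *)
Definition cell_index := (('I_N * 'I_M) * ('I_k.+1 * 'I_k.+1))%type.

Definition dg2_point (i : cell_index) : R * R :=
  (sample (X i.1.1) (X i.1.1.+1) k i.2.1, sample (Y i.1.2) (Y i.1.2.+1) k i.2.2).

(** Tensor-product Lagrange function of one open cell, extended by zero. *)
Definition dg2_basis (i : cell_index) (z : R * R) : R :=
  \1_(`]X i.1.1, X i.1.1.+1[%classic `*` `]Y i.1.2, Y i.1.2.+1[%classic) z
  * ((lagr (X i.1.1) (X i.1.1.+1) i.2.1).[z.1]
     * (lagr (Y i.1.2) (Y i.1.2.+1) i.2.2).[z.2]).

Lemma dg2_interp w z : dg2_mem m k w ->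
  dg2_val m w z = \sum_i dg2_val m w (dg2_point i) * dg2_basis i z.
Proof.
move=> Ww; rewrite {1}/dg2_val big_mkord.
under eq_bigr do rewrite big_mkord.
rewrite pair_bigA/=.
rewrite -(pair_bigA _ (fun (c : 'I_N * 'I_M) (l : 'I_k.+1 * 'I_k.+1) =>
  dg2_val m w (dg2_point (c, l)) * dg2_basis (c, l) z))/=.
apply: eq_bigr => -[i j] _ /=.
have [sx sy] := Ww i j (ltn_ord i) (ltn_ord j).
have Xi : X i < X i.+1 by case: meshX => _ _ _; apply.
have Yj : Y j < Y j.+1 by case: meshY => _ _ _; apply.
rewrite (horner2_lagr _ _ Xi Yj sx sy) pair_bigA big_distrr/=.
apply: eq_bigr => -[l n] _; rewrite (@dg2_val_cell w i j)//=; try exact: sample_in.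
by rewrite mulrCA.
Qed.

Lemma A0_2C w v : A0_2 m w v = A0_2 m v w.
Proof.
rewrite /A0_2; apply: f_equal2; first apply: f_equal2; apply: eq_bigr => i _;
  apply: eq_bigr => j _; apply: eq_Rintegral => z _.
- by congr (_ + _); rewrite mulrC.
- by rewrite addrC.
- by rewrite addrC.
Qed.

Lemma A0_2_sub u v w : A0_2 m (dg2_sub u v) w = A0_2 m u w - A0_2 m v w.
Proof.
have subD3 (p1 p2 p3 q1 q2 q3 : R) :
    p1 + p2 + p3 - (q1 + q2 + q3) = (p1 - q1) + (p2 - q2) + (p3 - q3) by ring.
rewrite /A0_2 [RHS]subD3.
(* [hor] treats polynomials along a line with first coordinate [s], and [ver] along one with second
   coordinate [s]; they serve the two families of interfaces. *)
have hor (p : {poly {poly R}}) (s r r' : R) : bmeas `[r, r'] (fun y => p.[s, y]).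
  exact: bmeas_horner2 (bmeas_cst _ _) (bmeas_itv _ _).
have ver (p : {poly {poly R}}) (s r r' : R) : bmeas `[r, r'] (fun x => p.[x, s]).
  exact: bmeas_horner2 (bmeas_itv _ _) (bmeas_cst _ _).
rewrite -!sumrB; congr (_ + _ + _); apply: eq_bigr => i _; rewrite -sumrB;
  apply: eq_bigr => j _; apply: RintegralB_bmeas.
- exact: measurable_rectangle.
- exact: lebesgue2_fin.
- by apply: bmeasD; apply: bmeasM; exact: bmeas_rectangle_horner2.
- by apply: bmeasD; apply: bmeasM; exact: bmeas_rectangle_horner2.
- by move=> z; rewrite px_sub py_sub; ring.
- by [].
- exact: lebesgue_itv_fin.
- apply: bmeasD; apply: bmeasM; try (by apply: bmeasB; exact: hor);
    by apply: bmeasM (bmeas_cst _ _); apply: bmeasD; exact: hor.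
- apply: bmeasD; apply: bmeasM; try (by apply: bmeasB; exact: hor);
    by apply: bmeasM (bmeas_cst _ _); apply: bmeasD; exact: hor.
- by move=> y; rewrite /avg /jump !px_sub !horner2_sub; ring.
- by [].
- exact: lebesgue_itv_fin.
- apply: bmeasD; apply: bmeasM; try (by apply: bmeasB; exact: ver);
    by apply: bmeasM (bmeas_cst _ _); apply: bmeasD; exact: ver.
- apply: bmeasD; apply: bmeasM; try (by apply: bmeasB; exact: ver);
    by apply: bmeasM (bmeas_cst _ _); apply: bmeasD; exact: ver.
- by move=> y; rewrite /avg /jump !py_sub !horner2_sub; ring.
Qed.

End TwoDim.

(** * Boundary terms on the rectangle *)

Section Boundary2.
Context {R : realType}.
Variables (m : mesh2 R) (bc : bcase) (beta0 beta1 : R) (g : R -> R * R -> bdata R).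
Hypothesis beta1_ge0 : bc = Clamped -> 0 <= beta1.
Hypothesis data_ok : data2_ok m bc g.
Local Notation N := (nx m).
Local Notation M := (ny m).
Local Notation X := (node (xlo m) (xhi m) N).
Local Notation Y := (node (ylo m) (yhi m) M).

Let data_sides (t : R) : 0 < t ->
  [/\ data_integrable lebesgue_measure `[ylo m, yhi m] bc (fun y => g t (xlo m, y)),
      data_integrable lebesgue_measure `[ylo m, yhi m] bc (fun y => g t (xhi m, y)),
      data_integrable lebesgue_measure `[xlo m, xhi m] bc (fun x => g t (x, ylo m)) &
      data_integrable lebesgue_measure `[xlo m, xhi m] bc (fun x => g t (x, yhi m))].
Proof.
move=> /data_ok; rewrite /data_integrable.
by case: (bc) => -[[? ? ? ?] [? ? ? ?]]; split; split.
Qed.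

Let data_integrableS (a b c e : R) (G : R -> bdata R) :
  `[a, b] `<=` `[c, e] ->
  data_integrable lebesgue_measure `[c, e] bc G ->
  data_integrable lebesgue_measure `[a, b] bc G.
Proof.
move=> sub; rewrite /data_integrable.
by case: (bc) => -[I1 I2]; (split; [apply: integrableS I1 | apply: integrableS I2]).
Qed.

Lemma bnd2_le (t : R) (u q u' q' : dg2 R) : 0 < t ->
  bnd2_first m bc beta0 beta1 g t u q (dg2_sub u u')
  - bnd2_first m bc beta0 beta1 g t u' q' (dg2_sub u u')
  <= bnd2_second m bc beta0 g t u (dg2_sub q q')
  - bnd2_second m bc beta0 g t u' (dg2_sub q q').
Proof.
move=> /data_sides[dl dr db dt].
have meshX : mesh1 (xlo m) (xhi m) N X := node_mesh1 (xlohi m) (nx_gt0 m).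
have meshY : mesh1 (ylo m) (yhi m) M Y := node_mesh1 (ylohi m) (ny_gt0 m).
have hor (p : {poly {poly R}}) (s r r' : R) : bmeas `[r, r'] (fun y => p.[s, y]).
  exact: bmeas_horner2 (bmeas_cst _ _) (bmeas_itv _ _).
have ver (p : {poly {poly R}}) (s r r' : R) : bmeas `[r, r'] (fun x => p.[x, s]).
  exact: bmeas_horner2 (bmeas_itv _ _) (bmeas_cst _ _).
have subD2 (p1 p2 q1 q2 : R) : p1 + p2 - (q1 + q2) = (p1 - q1) + (p2 - q2) by ring.
rewrite /bnd2_first /bnd2_second /int_Gamma [leLHS]subD2 [leRHS]subD2 -!sumrB.
have diam_ge0 : 0 <= diam2 m by exact: sqrtr_ge0.
(* The comparison is made edge by edge on the four sides; integrability of the data, known on a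
   whole side, is restricted to each edge. *)
apply: lerD; rewrite !big_mkord; apply: ler_sum => i _;
  rewrite [leLHS]subD2 [leRHS]subD2; apply: lerD;
  apply: Rintegral_bnd_le => //; try exact: lebesgue_itv_fin;
  try (by split; [exact: hor | try apply: bmeasN; exact: hor]);
  try (by split; [exact: ver | try apply: bmeasN; exact: ver]);
  try (by move=> z /=; rewrite ?px_sub ?py_sub ?horner2_sub ?opprD).
- exact: data_integrableS (mesh1_sub meshY (ltn_ord i)) dl.
- exact: data_integrableS (mesh1_sub meshY (ltn_ord i)) dr.
- exact: data_integrableS (mesh1_sub meshX (ltn_ord i)) db.
- exact: data_integrableS (mesh1_sub meshX (ltn_ord i)) dt.
Qed.

End Boundary2.

(** * Stability in two dimensions and the combined statement *)

Lemma dg2_stability {R : realType} (k : nat) (bc : bcase) (beta0 beta1 : R)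
    (m : mesh2 R) (g : R -> R * R -> bdata R) (u0 u0' : R * R -> R)
    (uh qh uh' qh' : R -> dg2 R) :
  (bc = Clamped -> 0 <= beta1) -> data2_ok m bc g ->
  L2_mem (lebesgue2 R) (rect m) u0 -> L2_mem (lebesgue2 R) (rect m) u0' ->
  dg2_solution m k bc beta0 beta1 g u0 uh qh ->
  dg2_solution m k bc beta0 beta1 g u0' uh' qh' ->
  forall t, 0 < t ->
    (L2_norm (lebesgue2 R) (rect m)
       (fun z => (dg2_val m (uh t) z - dg2_val m (uh' t) z)%R)
     <= L2_norm (lebesgue2 R) (rect m) (fun z => (u0 z - u0' z)%R))%E.
Proof.
move=> b1 dok L2u0 L2u0' sol sol' t t0.
refine (dg_stability (mu := lebesgue2 R) (sub := @dg2_sub R) (I := cell_index m k)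
  (pt := @dg2_point R m k) (L := @dg2_basis R m k)
  _ _ _ _ _ _ _ _ _ L2u0 L2u0' sol sol' t0).
- exact: measurable_rectangle.
- exact: lebesgue2_fin.
- exact: dg2_sub_mem.
- exact: dg2_val_sub.
- move=> i; apply: bmeasM; first by apply: bmeas_indic; exact: measurableX.
  apply: bmeasM.
    by apply: (bmeas_fst _ _ (bmeas_horner _ (bmeas_itv _ _))).
  by apply: (bmeas_snd _ _ (bmeas_horner _ (bmeas_itv _ _))).
- by move=> w Ww z; exact: dg2_interp.
- exact: A0_2C.
- exact: A0_2_sub.
- by move=> s u q u' q' s0; exact: bnd2_le.
Qed.

Theorem theorem4p3 (R : realType) (k : nat) (bc : bcase) (beta0 beta1 : R)
    (Hbeta1 : bc = Clamped -> 0 <= beta1) :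
  (forall (a b : R) (N : nat) (x : nat -> R) (g : R -> R -> bdata R)
      (u0 u0' : R -> R) (uh qh uh' qh' : R -> dg1 R),
    mesh1 a b N x ->
    L2_mem (@lebesgue_measure R) `[a, b]%classic u0 ->
    L2_mem (@lebesgue_measure R) `[a, b]%classic u0' ->
    dg1_solution a b k N x bc beta0 beta1 g u0 uh qh ->
    dg1_solution a b k N x bc beta0 beta1 g u0' uh' qh' ->
    forall t, 0 < t ->
      (L2_norm (@lebesgue_measure R) `[a, b]%classic
         (fun s => (dg1_val N x (uh t) s - dg1_val N x (uh' t) s)%R)
       <= L2_norm (@lebesgue_measure R) `[a, b]%classic
         (fun s => (u0 s - u0' s)%R))%E)
  /\
  (forall (m : mesh2 R) (g : R -> R * R -> bdata R)
      (u0 u0' : R * R -> R) (uh qh uh' qh' : R -> dg2 R),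
    data2_ok m bc g ->
    L2_mem (lebesgue2 R) (rect m) u0 ->
    L2_mem (lebesgue2 R) (rect m) u0' ->
    dg2_solution m k bc beta0 beta1 g u0 uh qh ->
    dg2_solution m k bc beta0 beta1 g u0' uh' qh' ->
    forall t, 0 < t ->
      (L2_norm (lebesgue2 R) (rect m)
         (fun z => (dg2_val m (uh t) z - dg2_val m (uh' t) z)%R)
       <= L2_norm (lebesgue2 R) (rect m) (fun z => (u0 z - u0' z)%R))%E).
Proof.
split.
- move=> a b N x g u0 u0' uh qh uh' qh' meshx L2u0 L2u0' sol sol'.
  exact: (dg1_stability Hbeta1 meshx L2u0 L2u0' sol sol').
- move=> m g u0 u0' uh qh uh' qh' dok L2u0 L2u0' sol sol'.
  exact: (dg2_stability Hbeta1 dok L2u0 L2u0' sol sol').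
Qed.
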